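(* Let $E \subseteq \mathbb{Z}^r$ be a set with positive upper Banach density, $d^*(E) > 0$. There exists an $n \in \mathbb{N}$ such that for any set $v_1, \dots, v_r \in \mathbb{Z}^r$ of linearly independent vectors, there are $v_0 \in E$ and $\gamma \in \operatorname{SL}_r(\mathbb{Z})$ such that $$v_0 + n\,\gamma(v_k) \in E \quad \text{for } k = 1, \dots, r.$$
   Context: Here $r$ is a positive integer and $\mathbb{N}$ denotes the positive integers. The upper Banach density of $E \subseteq \mathbb{Z}^r$ is $$d^*(E) := \limsup_{n\to\infty} \sup_{v \in \mathbb{Z}^r} \frac{|E \cap (v + [0,n-1]^r)|}{n^r}.$$ The group $\operatorname{SL}_r(\mathbb{Z})$ acts linearly on $\mathbb{Z}^r$ in the usual way.
   Formalization: The formal theorem assumes r ≥ 2; for r = 1 the claim is false, since SL_1(Z) is trivial and E = {m : frac(m√2) < 1/4} has positive upper Banach density but for every n some nonzero v_1 has n·v_1 outside E − E. *)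

(* Defs.v *)
From HB Require Import structures.
From mathcomp Require Import all_boot all_order all_algebra finmap.
From mathcomp Require Import all_classical all_reals all_analysis.

Set Implicit Arguments.
Unset Strict Implicit.
Unset Printing Implicit Defensive.

Import Order.TTheory GRing.Theory Num.Theory.

Local Open Scope classical_set_scope.
Local Open Scope ring_scope.

(* Z^r is the type 'cV[int]_r of column vectors, so that SL_r(Z) acts on it by
   left multiplication. *)

Definition cube (r n : nat) : set 'cV[int]_r :=
  [set w : 'cV[int]_r | forall i : 'I_r, 0 <= w i 0 <= n%:Z - 1].

Arguments cube : clear implicits.

(* fset_set A is the finite set of elements of A when A is finite (and empty
   otherwise); it is applied here only to subsets of a translate of a cube.
   The term n = 0, where the division is by 0, does not affect the limsup. *)
Definition upper_banach_density (R : realType) (r : nat) (E : set 'cV[int]_r) :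
    \bar R :=
  limn_esup (fun n : nat =>
    ereal_sup [set ((#|` fset_set (E `&` [set v + w | w in cube r n])|)%:R
                      / n%:R ^+ r)%:E | v in [set: 'cV[int]_r]]).

Arguments upper_banach_density R {r} E.

Definition SLZ (r : nat) : set 'M[int]_r := [set g : 'M[int]_r | \det g = 1].

Arguments SLZ : clear implicits.

(* Over Z, hence equivalently over Q or R. *)
Definition lin_indep (r m : nat) (v : 'I_m -> 'cV[int]_r) : Prop :=
  forall c : 'I_m -> int,
    \sum_(k < m) c k *: v k = 0 -> forall k : 'I_m, c k = 0.

(* Main.v *)
(** An ultrafilter limit of averages over larger and larger cubes in which E has
    density at least d > 0 is a translation-invariant mean Lam on bounded functions
    with Lam f > 0, where f is the indicator of E; the pairing Lam (F * H) makes the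
    translations unitary. For a subgroup S let the energy of S be the infimum of
    the squared norms of the averages of f over finite lists in S, which stands for
    the squared norm of the projection of f onto S-invariant functions. Choose n
    such that the energy of n * k * Z^r hardly exceeds that of n * Z^r for all k, and
    let g be an average of f of nearly minimal energy over n * Z^r. A subgroup of
    n * Z^r is good if its energy is close to that of n * Z^r; averages of f of
    nearly minimal energy over it are then close to g. By a Bessel inequality,
    among many subgroups of n * Z^r whose pairwise sums are good, one is good.
    Merging generators of Z^r one pair at a time yields a vector p with n * N * p
    generating a good subgroup for every N, and then, for all but boundedly many m,
    w = v_j + c m p generates a good subgroup after multiplication by n D.
    With D the determinant of the v_k, transvections 1 + p q, where q p = 0 and
    c = q v_j, send v_j to v_j + c m p, and a further transvection fixes
    w = v_j + c m p and adds independent arbitrary multiples of D w to the images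
    of the other v_k. Averaging over these multiples replaces the corresponding
    factors by g, averaging over m replaces the one for v_j by g, the remaining
    factor f can be replaced by g because g is almost invariant, and the mean of a
    power of g is bounded below in terms of Lam g = Lam f > 0. *)

From HB Require Import structures.
Require Import Defs.
From mathcomp Require Import all_boot all_order all_algebra finmap.
From mathcomp Require Import all_classical all_reals all_analysis.
From mathcomp Require Import ring lra zify.

Set Implicit Arguments.
Unset Strict Implicit.
Unset Printing Implicit Defensive.

Import Order.TTheory GRing.Theory Num.Theory.
Import numFieldNormedType.Exports.

Local Open Scope classical_set_scope.
Local Open Scope ring_scope.

(** * The algebra of bounded real functions *)

Section BoundedFunctions.
Variables (R : realType) (T : Type).

Definition bounded_fct : {pred T -> R} :=
  fun F => `[< exists C, forall x, `|F x| <= C >].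

Lemma bounded_fctP (F : T -> R) :
  reflect (exists C, forall x, `|F x| <= C) (F \in bounded_fct).
Proof. exact: asboolP. Qed.

Fact bounded_subring_closed : subring_closed bounded_fct.
Proof.
split.
- by apply/bounded_fctP; exists 1 => x; rewrite normr1.
- move=> F G /bounded_fctP[C FC] /bounded_fctP[D GD].
  apply/bounded_fctP; exists (C + D) => x.
  by apply: le_trans (ler_normB _ _) _; exact: lerD.
- move=> F G /bounded_fctP[C FC] /bounded_fctP[D GD].
  apply/bounded_fctP; exists (C * D) => x.
  by rewrite normrM; apply: ler_pM.
Qed.

Fact bounded_scaler_closed : GRing.scaler_closed bounded_fct.
Proof.
move=> c F /bounded_fctP[C FC]; apply/bounded_fctP; exists (`|c| * C) => x.
by rewrite normrM ler_wpM2l.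
Qed.

HB.instance Definition _ :=
  GRing.isSubringClosed.Build (T -> R) bounded_fct bounded_subring_closed.
HB.instance Definition _ :=
  GRing.isScaleClosed.Build R (T -> R) bounded_fct bounded_scaler_closed.

Record bfun := BFun { bfun_val :> T -> R; bfun_bounded : bfun_val \in bounded_fct }.
HB.instance Definition _ := [isSub for bfun_val].
HB.instance Definition _ := [Choice of bfun by <:].
HB.instance Definition _ := 
  GRing.SubChoice_isSubComPzRing.Build _ _ bfun bounded_subring_closed.
HB.instance Definition _ := [SubZmodule_isSubLmodule of bfun by <:].

Lemma bfunD (F G : bfun) x : (F + G) x = F x + G x.
Proof. by []. Qed.
Lemma bfunN (F : bfun) x : (- F) x = - F x.
Proof. by []. Qed.
Lemma bfun1 x : (1 : bfun) x = 1.
Proof. by []. Qed.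
Lemma bfunM (F G : bfun) x : (F * G) x = F x * G x.
Proof. by []. Qed.
Lemma bfunZ c (F : bfun) x : (c *: F) x = c * F x.
Proof. by []. Qed.
Lemma bfun_scaleAl c (F G : bfun) : (c *: F) * G = c *: (F * G).
Proof.
by apply/val_inj/funext => x; exact: esym (mulrA c (F x) (G x)).
Qed.
Lemma bfun_sum I (s : seq I) (F : I -> bfun) x : (\sum_(i <- s) F i) x = \sum_(i <- s) F i x.
Proof. by elim/big_rec2 : _ => // i y1 y2 _ <-. Qed.
Lemma bfun_prod I (s : seq I) (F : I -> bfun) x :
  (\prod_(i <- s) F i) x = \prod_(i <- s) F i x.
Proof. by elim/big_rec2 : _ => // i y1 y2 _ <-. Qed.
Lemma bfunX (F : bfun) k x : (F ^+ k) x = F x ^+ k.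
Proof. by elim: k => // k IH; rewrite !exprS -IH. Qed.
End BoundedFunctions.
Arguments bounded_fct {R T}.

(** Compare F with the constants c and -c. An arbitrary positive normalized functional is allowed,
    because this serves both the mean and the box averages from which the mean is built. *)
Lemma positive_norm_le (R : realType) (T : Type) (L : {scalar bfun R T}) :
  (forall F : bfun R T, (forall x, 0 <= F x) -> 0 <= L F) -> L 1 = 1 ->
  forall (F : bfun R T) (c : R), (forall x, `|F x| <= c) -> `|L F| <= c.
Proof.
move=> L0 L1 F c Fc; have Lc (d : R) : L (d *: (1 : bfun R T)) = d.
  by rewrite linearZ L1 /= mulr1.
have mono (H K : bfun R T) : (forall x, H x <= K x) -> L H <= L K.
  move=> HK; rewrite -subr_ge0 -linearB L0 // => x.
  by rewrite bfunD bfunN subr_ge0.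
rewrite ler_norml -[X in - X]Lc -[X in _ && (_ <= X)]Lc -linearN.
apply/andP; split; apply: mono => x; rewrite ?bfunN bfunZ bfun1 mulr1;
  by have := Fc x; rewrite ler_norml => /andP[].
Qed.

(** * Translations and invariant means *)

Section InvariantMean.
Variables (R : realType) (G : zmodType).
Local Notation bfun := (bfun R G).
Implicit Types (F H K : bfun) (h k : G) (l m : seq G).

Definition shift_val (h : G) (F : bfun) : G -> R := fun x => F (x + h).

Fact shift_bounded h F : shift_val h F \in bounded_fct.
Proof.
by have /bounded_fctP[C FC] := bfun_bounded F; apply/bounded_fctP; exists C => x; exact: FC.
Qed.

Definition shift h F : bfun := BFun (shift_bounded h F).

Lemma shiftE h F x : shift h F x = F (x + h).
Proof. by []. Qed.

Fact shift_is_linear h : linear (shift h).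
Proof. by move=> a F H; apply/val_inj/funext => x. Qed.
HB.instance Definition _ h := GRing.isLinear.Build R bfun bfun _ (shift h) (shift_is_linear h).

Lemma shiftZ h (c : R) F : shift h (c *: F) = c *: shift h F.
Proof. exact: linearZ. Qed.
Lemma shift_sum h I (s : seq I) (F : I -> bfun) :
  shift h (\sum_(i <- s) F i) = \sum_(i <- s) shift h (F i).
Proof. exact: linear_sum. Qed.

Lemma shiftM h F H : shift h (F * H) = shift h F * shift h H.
Proof. by apply/val_inj/funext => x. Qed.

Lemma shiftX h (j : nat) F : shift h (F ^+ j) = shift h F ^+ j.
Proof. by elim: j => [|j IH]; [apply/val_inj/funext|rewrite !exprS shiftM IH]. Qed.

Lemma shift_add h k F : shift (h + k) F = shift h (shift k F).
Proof. by apply/val_inj/funext => x; rewrite /= /shift_val /= addrA. Qed.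

Lemma shift0 F : shift 0 F = F.
Proof. by apply/val_inj/funext => x; rewrite /= /shift_val addr0. Qed.

Definition invariant_mean (Lam : bfun -> R) :=
  [/\ Lam 1 = 1, forall F : bfun, (forall x, 0 <= F x) -> 0 <= Lam F
    & forall h F, Lam (shift h F) = Lam F].

Variable Lam : {scalar bfun}.
Hypothesis mean_Lam : invariant_mean Lam.

Lemma mean1 : Lam 1 = 1.
Proof. by case: mean_Lam. Qed.
Lemma mean_ge0 F : (forall x, 0 <= F x) -> 0 <= Lam F.
Proof. by case: mean_Lam => _ + _; apply. Qed.
Lemma mean_shift h F : Lam (shift h F) = Lam F.
Proof. by case: mean_Lam. Qed.

Lemma mean_le F H : (forall x, F x <= H x) -> Lam F <= Lam H.
Proof.
move=> FH; rewrite -subr_ge0 -linearB mean_ge0 // => x.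
by rewrite bfunD bfunN subr_ge0.
Qed.

(** * The positive semidefinite pairing of a mean *)

Definition ip F H := Lam (F * H).

Lemma ipC F H : ip F H = ip H F.
Proof. by rewrite /ip mulrC. Qed.
Lemma ipDl F H K : ip (F + H) K = ip F K + ip H K.
Proof. by rewrite /ip mulrDl linearD. Qed.
Lemma ipNl F K : ip (- F) K = - ip F K.
Proof. by rewrite /ip mulNr linearN. Qed.
Lemma ipZl c F K : ip (c *: F) K = c * ip F K.
Proof. by rewrite /ip bfun_scaleAl linearZ. Qed.
Lemma ipDr F H K : ip K (F + H) = ip K F + ip K H.
Proof. by rewrite ipC ipDl !(ipC K). Qed.
Lemma ipNr F K : ip K (- F) = - ip K F.
Proof. by rewrite ipC ipNl ipC. Qed.
Lemma ipZr c F K : ip K (c *: F) = c * ip K F.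
Proof. by rewrite ipC ipZl ipC. Qed.
Lemma ip_suml I (s : seq I) (F : I -> bfun) K :
  ip (\sum_(i <- s) F i) K = \sum_(i <- s) ip (F i) K.
Proof. by rewrite /ip mulr_suml linear_sum. Qed.
Lemma ip_sumr I (s : seq I) (F : I -> bfun) K :
  ip K (\sum_(i <- s) F i) = \sum_(i <- s) ip K (F i).
Proof. by rewrite ipC ip_suml; under eq_bigr do rewrite ipC. Qed.
Definition ipE := (ipDl, ipDr, ipNl, ipNr, ipZl, ipZr).

Lemma ip_ge0 F : 0 <= ip F F.
Proof. by apply: mean_ge0 => x; rewrite bfunM -expr2 sqr_ge0. Qed.

Lemma ip_shift h F H : ip (shift h F) (shift h H) = ip F H.
Proof. by rewrite /ip -shiftM mean_shift. Qed.

Lemma ip_CS F H : ip F H ^+ 2 <= ip F F * ip H H.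
Proof.
set b := ip F H; set a := ip F F; set c := ip H H.
have c0 : 0 <= c := ip_ge0 H.
have quad s t : 0 <= s ^+ 2 * a + 2 * (s * t) * b + t ^+ 2 * c.
  have := ip_ge0 (s *: F + t *: H); rewrite !ipE (ipC H F) -/a -/b -/c.
  by congr (0 <= _); ring.
(* The pairing may be degenerate. For c > 0, taking s = c and t = -b gives c (a c - b^2) >= 0; for c
   = 0 and b nonzero, s = 1 and t = -(a + 1) / b would give the negative value -a - 2. *)
have [cpos|] := ltP 0 c.
  have h := quad c (- b).
  rewrite -(ler_pM2l cpos) -subr_ge0.
  by move: h; congr (0 <= _); ring.
move=> cle; have c00 : c = 0 by apply/eqP; rewrite eq_le cle c0.
rewrite c00 mulr0.
have [->|b0] := eqVneq b 0; first by rewrite expr0n.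
have := quad 1 (- (a + 1) / b).
rewrite c00 mulr0 addr0 expr1n !mul1r -mulrA divfK //.
have : 0 <= a := ip_ge0 F.
lra.
Qed.

Definition nrm F := Num.sqrt (ip F F).

Lemma nrm_ge0 F : 0 <= nrm F.
Proof. exact: sqrtr_ge0. Qed.
Lemma sqr_nrm F : nrm F ^+ 2 = ip F F.
Proof. by rewrite sqr_sqrtr ?ip_ge0. Qed.
Lemma nrm_leP F e : 0 <= e -> (nrm F <= e) = (ip F F <= e ^+ 2).
Proof.
by move=> e0; rewrite -sqr_nrm ler_sqr // nnegrE nrm_ge0.
Qed.
Lemma ip_le_nrm F H : `|ip F H| <= nrm F * nrm H.
Proof.
rewrite -(@ler_sqr _ `|_|) ?nnegrE ?mulr_ge0 ?nrm_ge0 //.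
by rewrite exprMn !sqr_nrm real_normK ?num_real // ip_CS.
Qed.
Lemma nrmD F H : nrm (F + H) <= nrm F + nrm H.
Proof.
rewrite nrm_leP ?addr_ge0 ?nrm_ge0 // !ipE (ipC H F) sqrrD !sqr_nrm.
have := le_trans (ler_norm _) (ip_le_nrm F H); lra.
Qed.
Lemma nrmN F : nrm (- F) = nrm F.
Proof. by rewrite /nrm ipNl ipNr opprK. Qed.
Lemma nrmB F H : nrm (F - H) = nrm (H - F).
Proof. by rewrite -nrmN opprB. Qed.
Lemma nrm_tri F H K : nrm (F - K) <= nrm (F - H) + nrm (H - K).
Proof. by rewrite -[F - K](subrKA H) nrmD. Qed.
Lemma nrmZ c F : nrm (c *: F) = `|c| * nrm F.
Proof.
by rewrite /nrm ipZl ipZr mulrA -expr2 sqrtrM ?sqr_ge0 // sqrtr_sqr.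
Qed.
Lemma nrm0 : nrm 0 = 0.
Proof. by rewrite -(scale0r 0) nrmZ normr0 mul0r. Qed.
Lemma nrm_sum I (s : seq I) (F : I -> bfun) :
  nrm (\sum_(i <- s) F i) <= \sum_(i <- s) nrm (F i).
Proof.
elim/big_rec2 : _ => [|i x y _ le]; first by rewrite nrm0.
by apply: le_trans (nrmD _ _) _; rewrite lerD2l.
Qed.
Lemma nrm_shift h F : nrm (shift h F) = nrm F.
Proof. by rewrite /nrm ip_shift. Qed.
Lemma mean_norm_le F (c : R) : (forall x, `|F x| <= c) -> `|Lam F| <= c.
Proof. exact: (positive_norm_le mean_ge0 mean1). Qed.

Lemma nrm_le1 F : (forall x, `|F x| <= 1) -> nrm F <= 1.
Proof.
move=> F1; rewrite nrm_leP // expr1n.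
apply: le_trans (ler_norm _) (mean_norm_le _) => x.
by rewrite [X in `|X|]bfunM normrM -(mulr1 1) ler_pM.
Qed.

Lemma mean_le_nrm F : `|Lam F| <= nrm F.
Proof.
have := ip_le_nrm F 1; rewrite /ip mulr1 => /le_trans; apply.
by rewrite ler_piMr ?nrm_ge0 // nrm_le1 // => x; rewrite normr1.
Qed.

Lemma nrmM_le F H : (forall x, `|F x| <= 1) -> nrm (F * H) <= nrm H.
Proof.
move=> F1; rewrite nrm_leP ?nrm_ge0 // sqr_nrm; apply: mean_le => x.
rewrite !bfunM -!expr2 exprMn ler_piMl ?sqr_ge0 //.
by rewrite -(expr1n _ 2) -[F x ^+ 2]real_normK ?num_real // ler_sqr ?nnegrE.
Qed.

(** * Averages over finite lists of translations *)

(** Lists count translations with multiplicity, so that averages compose over sumsets. The empty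
    list gives the zero function. *)
Definition avg (l : seq G) F : bfun := (size l)%:R^-1 *: \sum_(h <- l) shift h F.

Lemma size_neq0 (l : seq G) : l != [::] -> (size l)%:R != 0 :> R.
Proof. by rewrite pnatr_eq0 size_eq0. Qed.

Lemma avgE l F x : avg l F x = (size l)%:R^-1 * \sum_(h <- l) F (x + h).
Proof. by rewrite bfunZ bfun_sum. Qed.

Lemma avg_cst (V : lmodType R) l (a : V) : l != [::] ->
  (size l)%:R^-1 *: \sum_(h <- l : seq G) a = a.
Proof.
move=> l0; rewrite big_const_seq count_predT iter_addr_0 -[a *+ _]scaler_nat.
by rewrite scalerA mulVf ?scale1r // size_neq0.
Qed.

Lemma avg_close l (phi : G -> R) a e : l != [::] ->
  {in l, forall h, `|phi h - a| <= e} ->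
  `|(size l)%:R^-1 * (\sum_(h <- l) phi h) - a| <= e.
Proof.
move=> l0 le; rewrite -[X in _ - X](avg_cst (V := R^o) a l0).
rewrite -mulrBr -sumrB normrM ger0_norm ?invr_ge0 //.
rewrite -(avg_cst (V := R^o) e l0) ler_wpM2l ?invr_ge0 //.
apply: le_trans (ler_norm_sum _ _ _) _.
by rewrite big_seq [leRHS]big_seq; apply: ler_sum => h /le.
Qed.

Lemma ip_avgl l F H : ip (avg l F) H = (size l)%:R^-1 * \sum_(h <- l) ip (shift h F) H.
Proof. by rewrite ipZl ip_suml. Qed.

Lemma ip_avg_close l F H a e : l != [::] ->
  {in l, forall h, `|ip (shift h F) H - a| <= e} -> `|ip (avg l F) H - a| <= e.
Proof. by move=> l0 le; rewrite ip_avgl avg_close. Qed.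

Lemma avg_pt01 l F : (forall x, 0 <= F x <= 1) -> forall x, 0 <= avg l F x <= 1.
Proof.
move=> F01 x; rewrite avgE mulr_ge0 ?invr_ge0 ?sumr_ge0 //=; last first.
  by move=> h _; case/andP: (F01 (x + h)).
have [->|l0] := eqVneq l [::]; first by rewrite big_nil mulr0.
rewrite mulrC ler_pdivrMr ?ltr0n ?lt0n ?size_eq0 // mul1r.
rewrite -sum1_size natr_sum; apply: ler_sum => h _.
by case/andP: (F01 (x + h)).
Qed.

Lemma nrm_avg_sub l F H e : l != [::] ->
  {in l, forall h, nrm (shift h F - H) <= e} -> nrm (avg l F - H) <= e.
Proof.
move=> l0 le; rewrite -[X in _ - X](avg_cst H l0) -scalerBr -sumrB nrmZ.
rewrite ger0_norm ?invr_ge0 // -(avg_cst (V := R^o) e l0).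
rewrite ler_wpM2l ?invr_ge0 //; apply: le_trans (nrm_sum _ _) _.
by rewrite big_seq [leRHS]big_seq; apply: ler_sum => h /le.
Qed.

Lemma avg_shift h l F : avg l (shift h F) = shift h (avg l F).
Proof.
rewrite /avg shiftZ shift_sum; congr (_ *: _); apply: eq_bigr => k _.
by rewrite -[LHS]shift_add -[RHS]shift_add addrC.
Qed.

Lemma avg_map h l F : avg [seq h + k | k <- l] F = shift h (avg l F).
Proof.
rewrite /avg shiftZ shift_sum size_map big_map; congr (_ *: _).
by apply: eq_bigr => k _; rewrite shift_add.
Qed.

Definition sumset l m := [seq h + k | h <- l, k <- m].

Lemma avg_pair h F : avg [:: 0; h] F = 2^-1 *: (F + shift h F).
Proof. by rewrite /avg 2!big_cons big_nil addr0 shift0. Qed.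

Lemma avg_sumset l m F : avg (sumset l m) F = avg l (avg m F).
Proof.
rewrite /avg size_allpairs natrM invfM -scalerA; congr (_ *: _).
rewrite big_allpairs_dep scaler_sumr; apply: eq_bigr => h _.
rewrite shiftZ shift_sum; congr (_ *: _).
by apply: eq_bigr => k _; rewrite shift_add.
Qed.

Lemma avgC l m F : avg l (avg m F) = avg m (avg l F).
Proof.
rewrite -!avg_sumset /avg !size_allpairs mulnC; congr (_ *: _).
rewrite /sumset !big_allpairs_dep exchange_big; apply: eq_bigr => h _.
by apply: eq_bigr => k _; rewrite addrC.
Qed.

(** * Near-minimal averages *)

Definition subgroup (S : set G) := S 0 /\ forall x y, S x -> S y -> S (x - y).

Lemma subgroupN S x : subgroup S -> S x -> S (- x).
Proof. by move=> [S0 SB] Sx; rewrite -sub0r; exact: SB. Qed.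
Lemma subgroupD S x y : subgroup S -> S x -> S y -> S (x + y).
Proof.
by move=> gS Sx Sy; rewrite -[y]opprK; apply: gS.2 => //; exact: subgroupN.
Qed.

Definition multiples n : set G := [set x *+ n | x in setT].

Lemma multiples_subgroup n : subgroup (multiples n).
Proof.
split; first by exists 0; rewrite ?mul0rn.
by move=> _ _ [x _ <-] [y _ <-]; exists (x - y); rewrite ?mulrnBl.
Qed.

Definition lists (S : set G) : set (seq G) :=
  [set l | l != [::] /\ forall h, h \in l -> S h].

Lemma lists_sub S S' : S `<=` S' -> lists S `<=` lists S'.
Proof. by move=> SS' l [l0 Sl]; split=> // h /Sl /SS'. Qed.

Lemma lists_sumset S l m : subgroup S -> lists S l -> lists S m -> lists S (sumset l m).
Proof.
move=> gS [l0 Sl] [m0 Sm]; split.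
  by rewrite -size_eq0 size_allpairs muln_eq0 !size_eq0 negb_or l0.
by move=> _ /allpairsP[[h k] [/= /Sl Sh /Sm Sk ->]]; exact: subgroupD.
Qed.

Lemma lists_map S l h : subgroup S -> S h -> lists S l -> lists S [seq h + k | k <- l].
Proof.
move=> gS Sh [l0 Sl]; split; first by rewrite -size_eq0 size_map size_eq0.
by move=> _ /mapP[k /Sl Sk ->]; exact: subgroupD.
Qed.

Variable f : bfun.
Hypothesis f01 : forall x, 0 <= f x <= 1.

Let avg01 l := avg_pt01 l f01.

Lemma norm01 (c : R) : 0 <= c <= 1 -> `|c| <= 1.
Proof. by case/andP=> ? ?; rewrite ger0_norm. Qed.

Let f1 x : `|f x| <= 1. Proof. exact: norm01. Qed.
Let avg1 l x : `|avg l f x| <= 1. Proof. exact: norm01. Qed.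

Definition energy l := ip (avg l f) (avg l f).

Lemma energyE l : energy l = nrm (avg l f) ^+ 2.
Proof. by rewrite sqr_nrm. Qed.

Lemma energy_le1 l : energy l <= 1.
Proof. by rewrite energyE expr_le1 ?nrm_ge0 // nrm_le1. Qed.

Lemma energy_map h l : energy [seq h + k | k <- l] = energy l.
Proof. by rewrite /energy avg_map ip_shift. Qed.

Definition min_energy (S : set G) := inf [set energy l | l in lists S].

Lemma min_energy_has_inf S : subgroup S -> has_inf [set energy l | l in lists S].
Proof.
move=> [S0 _]; split; first exists (energy [:: 0]), [:: 0] => //.
  by split=> // h; rewrite inE => /eqP->.
by exists 0 => _ [l _ <-]; exact: ip_ge0.
Qed.

Lemma min_energy_le S l : lists S l -> min_energy S <= energy l.
Proof.
move=> Sl; apply: ge_inf; last by exists l.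
by exists 0 => _ [m _ <-]; exact: ip_ge0.
Qed.

Lemma min_energy_near S e : subgroup S -> 0 < e ->
  exists2 l, lists S l & energy l <= min_energy S + e ^+ 2.
Proof.
move=> gS e0; have e20 : 0 < e ^+ 2 by rewrite exprn_gt0.
have [_ [l Sl <-] lt] := inf_adherent e20 (min_energy_has_inf gS).
by exists l => //; exact: ltW.
Qed.

Lemma min_energy_le1 S : subgroup S -> min_energy S <= 1.
Proof.
move=> gS; have [l Sl _] := min_energy_near gS ltr01.
exact: le_trans (min_energy_le Sl) (energy_le1 l).
Qed.

(* Parallelogram law: the midpoint of [avg l f] and its translate is again an
   average over the subgroup, so its energy is at least the minimal one. *)
Lemma near_min_invariant S l e h : subgroup S -> lists S l -> 0 <= e ->
  energy l <= min_energy S + e ^+ 2 -> S h ->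
  nrm (shift h (avg l f) - avg l f) <= 2 * e.
Proof.
move=> gS Sl e0 le Sh; rewrite nrm_leP ?mulr_ge0 //.
have Sm : lists S (sumset [:: 0; h] l).
  apply: lists_sumset => //; split=> // k; rewrite !inE => /orP[]/eqP-> //.
  by case: gS.
have := min_energy_le Sm; move: le; rewrite /energy avg_sumset avg_pair.
move: (avg l f) => g; rewrite !ipE ip_shift (ipC (shift h g) g).
have -> : (2 * e) ^+ 2 = 4 * e ^+ 2 by rewrite exprMn; congr (_ * _); ring.
lra.
Qed.

Lemma stable_multiple e : 0 < e ->
  exists2 n, (0 < n)%N & forall k : nat, (0 < k)%N ->
    min_energy (multiples (n * k)) <= min_energy (multiples n) + e ^+ 2.
Proof.
(* Take n whose minimal energy nearly attains the supremum over all positive n: every n * k competes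
   in the same supremum. *)
move=> e0; pose A := [set min_energy (multiples n) | n in [set n | (0 < n)%N]].
have hA : has_sup A.
  split; first by exists (min_energy (multiples 1)), 1%N.
  by exists 1 => _ [n _ <-]; apply: min_energy_le1; exact: multiples_subgroup.
have e20 : 0 < e ^+ 2 by rewrite exprn_gt0.
have [_ [n n0 <-] lt] := sup_adherent e20 hA.
exists n => // k k0.
have : min_energy (multiples (n * k)) <= sup A.
  by apply: ub_le_sup; [case: hA|exists (n * k)%N; rewrite //= muln_gt0 n0].
move: lt; lra.
Qed.

(** * Good subgroups *)

(** A subgroup S of the multiples of n cannot have a smaller minimal energy than they have, so for
    such S goodness says that the two nearly agree. *)
Definition good n (S : set G) (e : R) :=
  exists2 l, lists S l & energy l <= min_energy (multiples n) + e ^+ 2.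

Lemma good_sub n S S' e : S `<=` S' -> good n S e -> good n S' e.
Proof. by move=> SS' [l /(lists_sub SS') Sl le]; exists l. Qed.

Lemma good_le n S e e' : 0 <= e -> e <= e' -> good n S e -> good n S e'.
Proof.
move=> e0 ee' [l Sl le]; exists l => //; apply: le_trans le _.
by rewrite lerD2l ler_sqr // nnegrE (le_trans e0).
Qed.

(** Both averages are compared with the double average over l1 and l2: translations from either list
    hardly move the near-minimal average over the other. *)
Lemma near_avg n l1 l2 e1 e2 : lists (multiples n) l1 -> lists (multiples n) l2 ->
  0 <= e1 -> 0 <= e2 ->
  energy l1 <= min_energy (multiples n) + e1 ^+ 2 ->
  energy l2 <= min_energy (multiples n) + e2 ^+ 2 ->
  nrm (avg l1 f - avg l2 f) <= 2 * e1 + 2 * e2.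
Proof.
move=> S1 S2 e10 e20 le1 le2; have gS := multiples_subgroup n.
apply: le_trans (nrm_tri _ (avg l1 (avg l2 f)) _) _; apply: lerD.
  rewrite nrmB avgC; apply: nrm_avg_sub; first by case: S2.
  by move=> h hl; apply: (near_min_invariant gS) => //; case: S2 => _; apply.
apply: nrm_avg_sub; first by case: S1.
by move=> h hl; apply: (near_min_invariant gS) => //; case: S1 => _; apply.
Qed.

Lemma normrB01 (a b : R) : 0 <= a <= 1 -> 0 <= b <= 1 -> `|a - b| <= 1.
Proof.
by move=> /andP[? ?] /andP[? ?]; rewrite ler_norml; apply/andP; split; lra.
Qed.

Lemma ip_close F H H' e : nrm F <= 1 -> nrm (H - H') <= e ->
  `|ip F H - ip F H'| <= e.
Proof.
move=> F1 He; rewrite -ipNr -ipDr; apply: le_trans (ip_le_nrm _ _) _.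
by apply: le_trans He; rewrite ler_piMl ?nrm_ge0.
Qed.

Let nf1 : nrm f <= 1. Proof. exact: nrm_le1. Qed.
Let navg1 l : nrm (avg l f) <= 1. Proof. exact: nrm_le1. Qed.

(** Each translation from m moves across the pairing onto [avg l f], which is almost invariant. *)
Lemma ip_near_min S l m e : subgroup S -> lists S l -> lists S m -> 0 <= e ->
  energy l <= min_energy S + e ^+ 2 ->
  `|ip (avg m f) (avg l f) - ip f (avg l f)| <= 2 * e.
Proof.
move=> gS Sl [m0 Sm] e0 le; apply: ip_avg_close => // h /Sm Sh.
rewrite -(ip_shift (- h)) -shift_add addNr shift0; apply: ip_close => //.
by apply: (near_min_invariant gS) => //; exact: subgroupN.
Qed.

Definition setadd (A B : set G) : set G := [set x + y | x in A & y in B].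

(** The averages over l1 and l2 act like projections onto S1- and S2-invariant functions. Their
    pairing hardly changes under translations from S1 + S2, and averaging over those turns
    [avg l2 f] into nearly [avg l f]. *)
Lemma near_min_ip_sum n S1 S2 l l1 l2 e :
  subgroup S1 -> S1 `<=` multiples n -> subgroup S2 -> S2 `<=` multiples n ->
  good n (setadd S1 S2) e -> 0 <= e ->
  lists (multiples n) l -> energy l <= min_energy (multiples n) + e ^+ 2 ->
  lists S1 l1 -> energy l1 <= min_energy S1 + e ^+ 2 ->
  lists S2 l2 -> energy l2 <= min_energy S2 + e ^+ 2 ->
  `|ip (avg l1 f) (avg l2 f) - ip (avg l1 f) (avg l f)| <= 10 * e.
Proof.
move=> gS1 S1n gS2 S2n [m mS mle] e0 lS lle l1S l1le l2S l2le.
have gn := multiples_subgroup n.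
have mn : lists (multiples n) m.
  apply: lists_sub mS => _ [x /S1n nx [y /S2n ny <-]]; exact: subgroupD.
(* For a translation x + y, the part x crosses the pairing as - x and is absorbed by [avg l1 f],
   while y is absorbed by [avg l2 f]. *)
have st1 : `|ip (avg m (avg l2 f)) (avg l1 f) - ip (avg l2 f) (avg l1 f)| <= 4 * e.
  apply: ip_avg_close => [|a /mS.2 [x S1x [y S2y <-]]]; first by case: mS.
  rewrite (_ : ip _ _ = ip (shift y (avg l2 f)) (shift (- x) (avg l1 f))); last first.
    by rewrite -(ip_shift (- x)) -shift_add addKr.
  rewrite (_ : 4 * e = 2 * e + 2 * e); last by ring.
  apply: le_trans (ler_distD (ip (shift y (avg l2 f)) (avg l1 f)) _ _) _.
  apply: lerD.
    apply: ip_close; first by rewrite nrm_shift.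
    by apply: (near_min_invariant gS1) => //; exact: subgroupN.
  rewrite ![ip _ (avg l1 f)]ipC; apply: ip_close => //.
  exact: (near_min_invariant gS2).
have st2 : nrm (avg m (avg l2 f) - avg l f) <= 6 * e.
  rewrite (_ : 6 * e = 2 * e + (2 * e + 2 * e)); last by ring.
  apply: le_trans (nrm_tri _ (avg m f) _) _; apply: lerD.
    rewrite avgC; apply: nrm_avg_sub; first by case: l2S.
    by move=> h /l2S.2/S2n nh; apply: (near_min_invariant gn).
  exact: (near_avg mn).
have := ip_close (navg1 l1) st2.
move: st1; rewrite ![ip _ (avg l1 f)]ipC !ler_norml.
by move=> /andP[? ?] /andP[? ?]; apply/andP; split; lra.
Qed.

(** * Almost orthogonal families and separation of subgroups *)

(** Cauchy-Schwarz for f and the sum of the u i gives (M b)^2 <= M + M^2 a; divide by M. *)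
Lemma bessel (M : nat) (u : 'I_M -> bfun) (a b : R) : 0 <= a -> 0 <= b ->
  (forall i, ip (u i) (u i) <= 1) ->
  (forall i j, i != j -> ip (u i) (u j) <= a) ->
  (forall i, b <= ip f (u i)) -> M%:R * b ^+ 2 <= 1 + M%:R * a.
Proof.
move=> a0 b0 u1 ua bu; case: M u u1 ua bu => [|M] u u1 ua bu.
  by rewrite !mul0r addr0.
have M0 : 0 < M.+1%:R :> R by rewrite ltr0n.
have cs := ip_CS f (\sum_i u i).
have low : M.+1%:R * b <= ip f (\sum_i u i).
  rewrite ip_sumr mulr_natl -[X in b *+ X]card_ord -sumr_const.
  exact: ler_sum.
have up : ip (\sum_i u i) (\sum_i u i) <= M.+1%:R * (1 + M.+1%:R * a).
  rewrite ip_suml mulr_natl -[X in _ *+ X]card_ord -sumr_const.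
  apply: ler_sum => i _; rewrite ip_sumr (bigD1 i) //= lerD //.
  apply: (@le_trans _ _ (\sum_(j < M.+1 | j != i) a)).
    by apply: ler_sum => j ji; apply: ua; rewrite eq_sym.
  rewrite [leRHS](_ : _ = \sum_(j < M.+1) a).
    by rewrite [leRHS](bigD1 i) //= lerDr.
  by rewrite sumr_const card_ord mulr_natl.
have ff1 : ip f f <= 1 by rewrite -sqr_nrm expr_le1 ?nrm_ge0.
rewrite -(ler_pM2l M0) (_ : M.+1%:R * (_ * b ^+ 2) = (M.+1%:R * b) ^+ 2); last by ring.
have low2 : (M.+1%:R * b) ^+ 2 <= ip f (\sum_i u i) ^+ 2.
  by rewrite ler_sqr ?nnegrE ?mulr_ge0 ?(le_trans _ low) ?mulr_ge0 // ltW.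
apply: le_trans low2 (le_trans cs (le_trans _ up)).
by rewrite ler_piMl ?ip_ge0.
Qed.

(* The vectors [avg (m i) f - avg l f], with [m i] nearly minimal in [S i] and [l]
   nearly minimal in the multiples of n, are almost orthogonal, while each of
   them has a correlation of at least about eta^2 with f if [S i] is not good. *)
Lemma separation eta : 0 < eta -> eta <= 1 ->
  exists2 th : R, 0 < th & exists M : nat, forall n (S : nat -> set G),
    (forall i, (i < M)%N -> subgroup (S i) /\ S i `<=` multiples n) ->
    (forall i j, (i < M)%N -> (j < M)%N -> i != j ->
      good n (setadd (S i) (S j)) th) ->
    exists2 i, (i < M)%N & good n (S i) eta.
Proof.
move=> eta0 eta1; set q := eta ^+ 2.
have q0 : 0 < q by rewrite exprn_gt0.
have q1 : q <= 1 by rewrite expr_le1 // ltW.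
have qq0 : 0 < q ^+ 2 by rewrite exprn_gt0.
have qq1 : q ^+ 2 <= q by rewrite expr2 ler_piMl // ltW.
(* The Bessel bound will read M (q - 5 th)^2 <= 1 + 18 M th. As q - 5 th >= q / 2, it gives M q^2
   (1/4 - 18/100) <= 1, which fails once M q^2 >= 40. *)
pose th := q ^+ 2 / 100; have thE : q ^+ 2 = 100 * th by rewrite /th; field.
have th0 : 0 < th by rewrite /th; lra.
exists th => //.
pose M := (Num.truncn (40 / q ^+ 2)).+1; exists M => n S gS goodS.
have Mq : 40 <= M%:R * q ^+ 2.
  by rewrite -ler_pdivrMr // ltW // /M truncnS_gt.
apply: contrapT => nogood.
have big i : (i < M)%N -> forall l, lists (S i) l -> min_energy (multiples n) + q < energy l.
  move=> iM l lS; rewrite ltNge; apply/negP => le.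
  by apply: nogood; exists i => //; exists l.
have [l lS lle] := min_energy_near (multiples_subgroup n) th0.
have /choice[m mP] : forall i : 'I_M, exists m,
    lists (S i) m /\ energy m <= min_energy (S i) + th ^+ 2.
  move=> i; have [m ? ?] := min_energy_near (gS i (ltn_ord i)).1 th0.
  by exists m.
have Sn i : S (nat_of_ord i) `<=` multiples n := (gS i (ltn_ord (i : 'I_M))).2.
have [th20 thth] : 0 <= th ^+ 2 /\ th ^+ 2 <= th.
  split; first exact: sqr_ge0.
  by rewrite expr2 ler_piMl //; rewrite /th; lra.
have gg0 : min_energy (multiples n) <= energy l by exact: min_energy_le.
have fg : `|energy l - ip f (avg l f)| <= 2 * th.
  by apply: (ip_near_min (multiples_subgroup n)) => //; rewrite ltW.
have ig i : `|ip (avg (m i) f) (avg l f) - energy l| <= 4 * th.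
  have h : `|ip (avg (m i) f) (avg l f) - ip f (avg l f)| <= 2 * th.
    apply: (ip_near_min (multiples_subgroup n)) => //; last by rewrite ltW.
    by apply: lists_sub (mP i).1.
  move: h fg; rewrite !ler_norml => /andP[? ?] /andP[? ?].
  by apply/andP; split; lra.
have fi i : energy (m i) - 2 * th <= ip f (avg (m i) f).
  have [mS mle] := mP i.
  have := ip_near_min (gS i (ltn_ord i)).1 mS mS (ltW th0) mle.
  by rewrite -/(energy _) ler_norml => /andP[? ?]; lra.
pose u i := avg (m i) f - avg l f.
have bes : M%:R * (q - 5 * th) ^+ 2 <= 1 + M%:R * (18 * th).
  apply: (bessel (u := u)).
  - by rewrite mulr_ge0 ?ltW.
  - by move: q0 qq1 q1 thE; lra.
  - move=> i; rewrite -sqr_nrm expr_le1 ?nrm_ge0 //; apply: nrm_le1 => x.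
    by rewrite bfunD bfunN normrB01.
  - move=> i j ij; rewrite /u !(ipDl, ipDr, ipNl, ipNr) (ipC (avg l f) (avg (m j) f)).
    have := near_min_ip_sum (gS i (ltn_ord i)).1 (@Sn i) (gS j (ltn_ord j)).1 (@Sn j)
      (goodS i j (ltn_ord i) (ltn_ord j) ij) (ltW th0) lS lle
      (mP i).1 (mP i).2 (mP j).1 (mP j).2.
    move: (ig j); rewrite !ler_norml => /andP[? ?] /andP[? ?]; lra.
  - move=> i; rewrite /u ipDr ipNr; have := big i (ltn_ord i) (m i) (mP i).1.
    move: (fi i) fg; rewrite ler_norml => ? /andP[? ?]; lra.
have qb : q ^+ 2 / 4 <= (q - 5 * th) ^+ 2.
  have -> : q ^+ 2 / 4 = (q / 2) ^+ 2 by field.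
  by rewrite ler_sqr ?nnegrE; move: q0 qq1 q1 thE; lra.
have M0 : 0 <= M%:R :> R by [].
have := ler_wpM2l M0 qb; move: bes Mq; rewrite thE.
have -> : M%:R * (18 * th) = 18 * (M%:R * th) by ring.
have -> : M%:R * (100 * th) = 100 * (M%:R * th) by ring.
have -> : M%:R * (100 * th / 4) = 25 * (M%:R * th) by field.
by lra.
Qed.

(** * Good directions *)

Fixpoint span (s : seq G) : set G :=
  if s is a :: s' then [set x | exists b : int, span s' (x - a *~ b)] else [set 0].

Lemma span_subgroup s : subgroup (span s).
Proof.
elim: s => [|a s [IH0 IHB]]; first by split=> // x y -> ->; rewrite /= subr0.
split; first by exists 0; rewrite mulr0z subr0.
move=> x y [b sx] [c sy]; exists (b - c).
have -> : x - y - a *~ (b - c) = (x - a *~ b) - (y - a *~ c).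
  by rewrite mulrzBr !opprB addrACA [RHS]addrACA [- y + _]addrC.
exact: IHB.
Qed.

Definition scaled (N : nat) (S : set G) : set G := [set x *+ N | x in S].

Lemma scaled_subgroup N S : subgroup S -> subgroup (scaled N S).
Proof.
move=> [S0 SB]; split; first by exists 0; rewrite ?mul0rn.
by move=> _ _ [x Sx <-] [y Sy <-]; exists (x - y); [exact: SB|rewrite mulrnBl].
Qed.

Lemma subgroupMn S x (N : nat) : subgroup S -> S x -> S (x *+ N).
Proof.
move=> gS Sx; elim: N => [|N IH]; first by rewrite mulr0n; case: gS.
by rewrite mulrS; exact: subgroupD.
Qed.

Lemma subgroupMz S x (b : int) : subgroup S -> S x -> S (x *~ b).
Proof.
move=> gS Sx; case: b => N; first exact: subgroupMn.
by rewrite NegzE mulrNz; apply: subgroupN => //; exact: subgroupMn.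
Qed.

Lemma scaled_dvd (N N' : nat) S : (N %| N')%N -> subgroup S ->
  scaled N' S `<=` scaled N S.
Proof.
move=> /dvdnP[k ->] gS _ [x Sx <-]; exists (x *+ k); first exact: subgroupMn.
by rewrite mulrnA.
Qed.

Lemma scaled_multiples n N S : scaled (n * N) S `<=` multiples n.
Proof. by move=> _ [x _ <-]; exists (x *+ N); rewrite // -mulrnA mulnC. Qed.

(* Eliminating p and q from [p + q = (i - j) c] and [i p + j q = (i - j) d]. *)
Lemma span_pair_sum (i j : int) a b s x : span [:: a, b & s] x ->
  setadd (span (a + b *~ i :: s)) (span (a + b *~ j :: s)) (x *~ (i - j)).
Proof.
move=> [c [d sx]].
have [y -> sy] : exists2 y, x = a *~ c + (b *~ d + y) & span s y.
  by exists (x - a *~ c - b *~ d); rewrite ?subrKC.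
exists ((a + b *~ i) *~ (d - j * c) + y *~ (i - j)).
  by exists (d - j * c); rewrite addrC addKr; apply: subgroupMz => //; exact: span_subgroup.
exists ((a + b *~ j) *~ (i * c - d)).
  by exists (i * c - d); rewrite subrr; case: (span_subgroup s).
rewrite [LHS]addrAC !mulrzDl [X in X + _ = _]addrACA -!mulrzA -!mulrzDr [RHS]addrA.
by congr (_ *~ _ + _ *~ _ + _); ring.
Qed.

(** For distinct i and j the subgroups with first generators a + i b and a + j b have a sum
    containing i - j times the whole span. So all pairwise sums are good at every scale, and
    separation provides a good candidate. *)
Lemma good_merge eta : 0 < eta -> eta <= 1 ->
  exists2 th : R, 0 < th & forall n a b s,
    (forall N, (0 < N)%N -> good n (scaled (n * N) (span [:: a, b & s])) th) ->
    exists i : int, forall N, (0 < N)%N ->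
      good n (scaled (n * N) (span (a + b *~ i :: s))) eta.
Proof.
move=> eta0 eta1; have [th th0 [M sep]] := separation eta0 eta1.
exists th => // n a b s goodab; apply: contrapT => nogood.
have /choice[N NP] : forall i : nat, exists N : nat, (0 < N)%N /\
    ~ good n (scaled (n * N) (span (a + b *~ i :: s))) eta.
  move=> i; apply: contrapT => noN; apply: nogood; exists i => N N0.
  by apply: contrapT => ngood; apply: noN; exists N.
(* A single i must serve all N. If each i failed at its own scale N i, all i < M would fail at the
   common multiple N0, since goodness passes to larger subgroups. *)
pose N0 := (\prod_(i < M) N i)%N.
have N00 : (0 < N0)%N by apply: prodn_gt0 => i; exact: (NP i).1.
have [||i iM] := sep n (fun i : nat => scaled (n * N0) (span (a + b *~ i :: s))).
- move=> i _; split; last exact: scaled_multiples.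
  exact/scaled_subgroup/span_subgroup.
- move=> i j iM jM ij.
  have ij0 : (0 < `|i%:Z - j%:Z|)%N by rewrite absz_gt0 subr_eq0 eqz_nat.
  apply: good_sub (goodab (N0 * `|i%:Z - j%:Z|)%N _); last by rewrite muln_gt0 N00.
  move=> _ [x sx <-].
  (* The sign turns the natural factor |i - j| into the integer i - j. *)
  have sx' : span [:: a, b & s] (x *~ sgz (i%:Z - j%:Z)).
    by apply: subgroupMz => //; exact: span_subgroup.
  have [y sy [z sz yz]] := span_pair_sum i j sx'.
  exists (y *+ (n * N0)); first by exists y.
  exists (z *+ (n * N0)); first by exists z.
  rewrite -mulrnDl yz !pmulrn -!mulrzA !PoszM abszEsg.
  by congr (x *~ _); ring.
- move=> gi; apply: (NP i).2; apply: good_sub gi.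
  apply: scaled_dvd; last exact: span_subgroup.
  apply: dvdn_mul => //; rewrite /N0 (bigD1 (Ordinal iM)) //=; exact: dvdn_mulr.
Qed.

(** Iterate the merging, choosing the thresholds backwards from eta. The initial one depends only on
    k and eta, so that n can be chosen after it. *)
Lemma good_direction (k : nat) eta : 0 < eta -> eta <= 1 ->
  exists2 th : R, 0 < th & forall n a s, size s = k ->
    (forall N, (0 < N)%N -> good n (scaled (n * N) (span (a :: s))) th) ->
    exists p : G, forall N, (0 < N)%N -> good n (scaled (n * N) (span [:: p])) eta.
Proof.
move=> eta0 eta1; elim: k => [|k [th th0 IH]].
  by exists eta => // n a s /size0nil-> ga; exists a.
have th10 : 0 < Num.min th 1 by rewrite lt_min th0 ltr01.
have th11 : Num.min th 1 <= 1 by rewrite ge_min lexx orbT.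
have [th' th'0 step] := good_merge th10 th11.
exists th' => // n a [//|b s] [sk] /step[i gi].
apply: IH sk _ => N N0; apply: good_le (gi N N0); first exact: ltW.
by rewrite ge_min lexx.
Qed.

Lemma good_multiple a s eta : span (a :: s) = setT -> 0 < eta -> eta <= 1 ->
  exists2 n, (0 < n)%N & exists p : G, forall N, (0 < N)%N ->
    good n (scaled (n * N) (span [:: p])) eta.
Proof.
move=> spanT eta0 eta1; have [th th0 dir] := good_direction (size s) eta0 eta1.
(* Half of th goes to the choice of n and half to a near-minimal list at scale n * N: the two
   squares add up to th^2 / 2. *)
have th20 : 0 < th / 2 by rewrite divr_gt0.
have [n n0 nP] := stable_multiple th20; exists n => //.
apply: (dir n a s erefl) => N N0.
have [l lS le] := min_energy_near (multiples_subgroup (n * N)) th20.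
exists l; first by rewrite spanT.
apply: le_trans le _; have := nP N N0.
have -> : th ^+ 2 = 4 * (th / 2) ^+ 2 by field.
have := sqr_ge0 (th / 2); lra.
Qed.

(** * Cyclic subgroups along lines in direction p *)

Definition cyclic_multiples (v : G) (c : int) : set G := [set v *~ (b * c) | b in setT].

Lemma cyclic_subgroup v c : subgroup (cyclic_multiples v c).
Proof.
split; first by exists 0; rewrite ?mul0r.
move=> _ _ [b _ <-] [b' _ <-]; exists (b - b') => //.
by rewrite mulrBl mulrzBr.
Qed.

Lemma scaled_span1 N v : scaled N (span [:: v]) = cyclic_multiples v N.
Proof.
rewrite eqEsubset; split=> [y [x [b /= /eqP]]|y [b _ <-]].
  rewrite subr_eq0 => /eqP-> <-; exists b => //.
  by rewrite [RHS]pmulrn -mulrzA.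
by exists (v *~ b); [exists b; rewrite /= subrr|rewrite mulrzA].
Qed.

Lemma cyclicN v c : cyclic_multiples v (- c) = cyclic_multiples v c.
Proof.
by rewrite eqEsubset; split=> _ [b _ <-]; exists (- b) => //; rewrite ?mulrNN ?mulNr ?mulrN.
Qed.

Lemma cyclic_abs v c : cyclic_multiples v `|c| = cyclic_multiples v c.
Proof. by have [_|_] := ger0P c; rewrite ?cyclicN. Qed.

(** Opposite multiples of the two generators cancel v and leave a multiple of p. *)
Lemma cyclic_lines_sum (v p : G) (c d m m' : int) :
  cyclic_multiples p (d * (c * (m - m'))) `<=`
  setadd (cyclic_multiples (v + p *~ (c * m)) d) (cyclic_multiples (v + p *~ (c * m')) d).
Proof.
move=> _ [b _ <-]; exists ((v + p *~ (c * m)) *~ (b * d)); first by exists b.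
exists ((v + p *~ (c * m')) *~ (- b * d)); first by exists (- b).
rewrite mulNr mulrNz -mulrzBl opprD addrACA subrr add0r -mulrzBr -mulrzA.
by congr (_ *~ _); ring.
Qed.

(** Two distinct points of the line generate a sum containing a nonzero multiple of p, so separation
    forbids M distinct bad parameters. If every t failed, M widely spaced values of t would produce
    them. *)
Lemma good_lines eta : 0 < eta -> eta <= 1 ->
  exists2 th : R, 0 < th & forall (n : nat) (p v : G) (c D : int),
    (0 < n)%N -> c != 0 -> D != 0 ->
    (forall N, (0 < N)%N -> good n (scaled (n * N) (span [:: p])) th) ->
    forall ms : seq int, exists t : int, forall m : int, m \in ms ->
      good n (cyclic_multiples (v + p *~ (c * (m + t))) (n%:Z * D)) eta.
Proof.
move=> eta0 eta1; have [th th0 [M sep]] := separation eta0 eta1.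
exists th => // n p v c D n0 c0 D0 goodp ms; apply: contrapT => nogood.
(* All elements of ms lie strictly between -K and K, so translates of this range by distinct
   multiples of 2 K are disjoint. *)
pose K := (\sum_(m <- ms) `|m|).+1%N.
have msK (m : int) : m \in ms -> (`|m| < K)%N.
  by move=> mms; rewrite /K ltnS (big_rem m) //= leq_addr.
have /choice[m mP] : forall i : nat, exists m : int, m \in ms /\
    ~ good n (cyclic_multiples (v + p *~ (c * (m + (2 * K * i)%N))) (n%:Z * D)) eta.
  move=> i; apply: contrapT => nom; apply: nogood; exists (2 * K * i)%N => m mms.
  by apply: contrapT => ngood; apply: nom; exists m.
pose t i : int := m i + (2 * K * i)%N.
have [||i iM] := sep n (fun i => cyclic_multiples (v + p *~ (c * t i)) (n%:Z * D)).
- move=> i _; split; first exact: cyclic_subgroup.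
  move=> _ [b _ <-]; exists ((v + p *~ (c * t i)) *~ (b * D)) => //.
  by rewrite pmulrn -mulrzA; congr (_ *~ _); ring.
- move=> i j _ _ ij.
  have tij : t i - t j != 0.
    have := msK _ (mP i).1; have := msK _ (mP j).1; rewrite /t.
    move: (m i) (m j) ij => mi mj; rewrite neq_ltn => /orP[] ij mjK miK.
      have : (2 * K * i + 2 * K <= 2 * K * j)%N by rewrite -mulnSr leq_mul2l ij orbT.
      by lia.
    have : (2 * K * j + 2 * K <= 2 * K * i)%N by rewrite -mulnSr leq_mul2l ij orbT.
    by lia.
  apply: good_sub (@cyclic_lines_sum v p c (n%:Z * D) (t i) (t j)) _.
  rewrite -cyclic_abs.
  have := goodp `|(D * (c * (t i - t j)))%R|%N _; rewrite scaled_span1.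
  rewrite absz_gt0 !mulf_neq0 // => /(_ isT).
  by rewrite PoszM abszE -mulrA [in X in _ -> X]normrM.
- exact: (mP i).2.
Qed.

Lemma cyclic_list v (c : int) (l : seq G) : (forall h, h \in l -> cyclic_multiples v c h) ->
  exists ms : seq int, l = [seq v *~ (m * c) | m : int <- ms].
Proof.
elim: l => [|h l IH] lP; first by exists [::].
have [b _ bh] := lP h (mem_head _ _).
have [|ms ->] := IH; first by move=> k kl; apply: lP; rewrite inE kl orbT.
by exists (b :: ms); rewrite /= bh.
Qed.

(** One list plays two roles: its average in direction p is nearly minimal, and each of its points
    gives a good line. Translating the list to reach good lines does not change its energy. *)
Lemma good_walk a s eta : span (a :: s) = setT -> 0 < eta -> eta <= 1 ->
  exists2 n, (0 < n)%N & exists p : G, forall (v : G) (c D : int), c != 0 -> D != 0 ->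
    exists ms : seq int, let l := [seq p *~ (m * (n%:Z * c)) | m : int <- ms] in
      [/\ ms != [::], energy l <= min_energy (multiples n) + eta ^+ 2
        & forall m : int, m \in ms ->
          good n (cyclic_multiples (v + p *~ (c * m)) (n%:Z * D)) eta].
Proof.
move=> spanT eta0 eta1; have [th th0 lines] := good_lines eta0 eta1.
have th10 : 0 < Num.min th eta by rewrite lt_min th0.
have th11 : Num.min th eta <= 1 by rewrite ge_min eta1 orbT.
have [n n0 [p pP]] := good_multiple spanT th10 th11.
exists n => //; exists p => v c D c0 D0.
have [|l [l0 lS] le] := pP `|c|%N; first by rewrite absz_gt0.
have /cyclic_list[ms lE] : forall h, h \in l -> cyclic_multiples p (n%:Z * c) h.
  move=> h /lS; rewrite scaled_span1 -(cyclic_abs p (n%:Z * c)).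
  by rewrite PoszM abszE normrM.
have [|t tP] := lines n p v c D n0 c0 D0 _ ms.
  move=> N N0; apply: good_le (pP N N0); first exact: ltW.
  by rewrite ge_min lexx.
exists [seq m + t | m : int <- ms]; split.
- by move: l0; rewrite lE -!size_eq0 !size_map.
- rewrite (_ : map _ _ = [seq p *~ (t * (n%:Z * c)) + h | h <- l]); last first.
    by rewrite lE -!map_comp; apply: eq_map => k /=; rewrite -mulrzDr -mulrDl addrC.
  rewrite energy_map; apply: le_trans le _.
  rewrite lerD2l ler_sqr ?nnegrE ?(ltW th10) ?(ltW eta0) //.
  by rewrite ge_min lexx orbT.
- by move=> _ /mapP[m mms ->]; exact: tP.
Qed.

(** * Recurrence *)

(** Replace the factors one at a time; the other factors are bounded by 1, so each replacement costs
    at most e. *)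
Lemma mean_prod_close I (s : seq I) F (g : bfun) (H : I -> bfun) (e : R) : 0 <= e ->
  (forall x, `|F x| <= 1) -> (forall x, `|g x| <= 1) ->
  (forall i x, `|H i x| <= 1) -> (forall i, nrm (H i - g) <= e) ->
  `|Lam (F * \prod_(i <- s) H i) - Lam (F * g ^+ size s)| <= (size s)%:R * e.
Proof.
move=> e0 + g1 H1 He; elim: s F => [|i s IH] F F1.
  by rewrite big_nil expr0 subrr normr0 mul0r.
rewrite big_cons mulrA /= exprS mulrA -addn1 natrD mulrDl mul1r.
apply: le_trans (ler_distD (Lam (F * H i * g ^+ size s)) _ _) _; apply: lerD.
  by apply: IH => x; rewrite bfunM normrM mulr_ile1.
rewrite -linearB (_ : _ - _ = (F * g ^+ size s) * (H i - g)); last by ring.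
apply: le_trans (mean_le_nrm _) (le_trans (nrmM_le _ _) (He i)) => x.
rewrite bfunM bfunX normrM normrX mulr_ile1 ?exprn_ile1 //.
Qed.

Lemma mean_gt0_ex F : 0 < Lam F -> exists x, 0 < F x.
Proof.
move=> F0; apply: contrapT => noF; move: F0; apply/negP; rewrite -leNgt.
rewrite -(linear0 Lam); apply: mean_le => x; rewrite leNgt; apply/negP => Fx.
by apply: noF; exists x.
Qed.

Lemma avg_gt0_ex l x : 0 < avg l f x -> exists2 h, h \in l & 0 < f (x + h).
Proof.
rewrite avgE => pos; apply: contrapT => nof; move: pos; apply/negP; rewrite -leNgt.
rewrite mulr_ge0_le0 ?invr_ge0 // big_seq; apply: sumr_le0 => h hl.
by rewrite leNgt; apply/negP => fx; apply: nof; exists h.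
Qed.

Lemma mean_avg l F : l != [::] -> Lam (avg l F) = Lam F.
Proof.
move=> l0; rewrite linearZ linear_sum /=; under eq_bigr do rewrite mean_shift.
exact: (avg_cst (V := R^o)).
Qed.

(** Pointwise g^(k+1) >= d^k (g - d): for g < d the right side is nonpositive. The mean of the right
    side is d^k (2 d - d). *)
Lemma mean_expr_ge (g : bfun) (d : R) (k : nat) : 0 <= d -> (forall x, 0 <= g x) ->
  Lam g = 2 * d -> d ^+ k.+1 <= Lam (g ^+ k.+1).
Proof.
move=> d0 g0 Lg.
have -> : d ^+ k.+1 = Lam (d ^+ k *: (g - d *: (1 : bfun))).
  by rewrite linearZ linearB linearZ mean1 /= Lg exprSr; ring.
apply: mean_le => x; rewrite bfunZ bfunX exprSr bfunD bfunN bfunZ bfun1 mulr1.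
have [dg|gd] := leP d (g x).
  by rewrite ler_pM ?exprn_ge0 ?subr_ge0 ?lerXn2r ?nnegrE ?gerBl.
apply: (@le_trans _ _ 0); last by rewrite mulr_ge0 ?exprn_ge0.
by rewrite mulr_ge0_le0 ?exprn_ge0 // subr_le0 ltW.
Qed.

(** The order of choices matters: n and p precede v, c, D; then m is fixed before u is known, and
    only x and the multiples b depend on u. *)
Lemma recurrence a s (k : nat) : span (a :: s) = setT -> 0 < Lam f ->
  exists2 n, (0 < n)%N & exists p : G, forall (v : G) (c D : int), c != 0 -> D != 0 ->
    exists m : int, let w := v + p *~ (c * m) in
      forall u : seq G, size u = k ->
        exists x, [/\ 0 < f x, 0 < f (x + w *+ n)
          & forall y, y \in u -> exists b : int, 0 < f (x + y *+ n + w *~ (b * (n%:Z * D)))].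
Proof.
move=> spanT Lf0; pose d := Lam f / 2; pose X := d ^+ k.+2.
have d0 : 0 < d by rewrite divr_gt0.
have X0 : 0 < X by rewrite exprn_gt0.
have X1 : X <= 1.
  rewrite exprn_ile1 ?(ltW d0) // ler_pdivrMr // mul1r.
  have := mean_norm_le f1; rewrite ler_norml => /andP[_ ?]; lra.
(* Replacements cost 4 eta each: k + 1 of them in [A1], one in [A2] and k in [A4]. That is (8 k + 8)
   eta, and the 9 leaves a positive remainder. *)
pose K : R := (k%:R * 8 + 9); have kR : 0 <= k%:R :> R by [].
have K1 : 1 <= K by rewrite /K; lra.
have K0 : 0 < K by rewrite (lt_le_trans ltr01).
pose eta := X / K; have eta0 : 0 < eta by rewrite divr_gt0.
have XE : X = k%:R * eta * 8 + eta * 9.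
  have -> : X = eta * K by rewrite divfK ?gt_eqF.
  by rewrite /K; ring.
have eta1 : eta <= 1 by rewrite ler_pdivrMr // mul1r (le_trans X1).
have [n n0 [p pP]] := good_walk spanT eta0 eta1.
have gn := multiples_subgroup n.
have [l lS lle] := min_energy_near gn eta0.
exists n => //; exists p => v c D c0 D0.
have [ms [ms0 mle mgood]] := pP v c D c0 D0.
set g := avg l f.
have near m : lists (multiples n) m -> energy m <= min_energy (multiples n) + eta ^+ 2 ->
    nrm (avg m f - g) <= 4 * eta.
  move=> mS me; rewrite (_ : 4 * eta = 2 * eta + 2 * eta); last by ring.
  exact: (near_avg mS lS (ltW eta0) (ltW eta0)).
have near_shift h m : multiples n h -> lists (multiples n) m ->
    energy m <= min_energy (multiples n) + eta ^+ 2 ->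
    nrm (shift h (avg m f) - g) <= 4 * eta.
  move=> nh mS me; rewrite -avg_map; apply: near; rewrite ?energy_map //.
  exact: lists_map.
have g1 x : `|g x| <= 1 := avg1 l x.
have eta40 : 0 <= 4 * eta by rewrite mulr_ge0 // ltW.
have gk1 j x : `|(g ^+ j) x| <= 1 by rewrite bfunX normrX exprn_ile1.
(* One factor g of g^(k+2) is an average of translates of f; moving each translation onto the almost
   invariant remaining factors replaces that g by f. *)
have A1 : X - k.+1%:R * (4 * eta) <= Lam (f * g ^+ k.+1).
  have : `|ip (avg l f) (g ^+ k.+1) - ip f (g ^+ k.+1)| <= k.+1%:R * (4 * eta).
    apply: ip_avg_close => [|h /lS.2 nh]; first by case: lS.
    rewrite -(ip_shift (- h)) -shift_add addNr shift0.
    have -> : shift (- h) (g ^+ k.+1) = \prod_(i <- nseq k.+1 tt) shift (- h) g.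
      by rewrite big_const_seq count_predT size_nseq iter_mulr_1 shiftX.
    have := @mean_prod_close _ (nseq k.+1 tt) f g (fun=> shift (- h) g) _ eta40 f1 g1.
    rewrite size_nseq; apply=> _; first by move=> x; rewrite shiftE.
    by apply: near_shift => //; exact: subgroupN.
  have : X <= Lam (g ^+ k.+2).
    apply: mean_expr_ge; rewrite ?(ltW d0) //.
      by move=> x; case/andP: (avg01 l x).
    by rewrite mean_avg; [rewrite /d; field|case: lS].
  rewrite exprS -/(ip g _) -/g ler_norml /ip => ? /andP[? ?]; lra.
(* Averaging the translate of f at n (v + c m p) over the walk gives a translate of a near-minimal
   average, hence nearly g. *)
have A2 : Lam (f * g ^+ k.+1) - 4 * eta <=
    (size ms)%:R^-1 * \sum_(b <- ms) Lam (f * shift ((v + p *~ (c * b)) *+ n) f * g ^+ k).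
  set l' := map _ ms in mle.
  have l'S : lists (multiples n) l'.
    split; first by rewrite -size_eq0 size_map size_eq0.
    move=> _ /mapP[b _ ->]; exists (p *~ (b * c)) => //.
    by rewrite pmulrn -mulrzA; congr (_ *~ _); ring.
  have nv : multiples n (v *+ n) by exists v.
  have F1 : nrm (f * g ^+ k) <= 1.
    by apply: nrm_le1 => x; rewrite bfunM normrM mulr_ile1.
  have := ip_close F1 (near_shift _ _ nv l'S mle).
  have -> : (size ms)%:R^-1 * \sum_(b <- ms) Lam (f * shift ((v + p *~ (c * b)) *+ n) f * g ^+ k)
     = ip (f * g ^+ k) (shift (v *+ n) (avg l' f)).
    rewrite -avg_shift ipC ip_avgl size_map big_map; congr (_ * _).
    apply: eq_bigr => m _; rewrite -shift_add /ip; congr (Lam _).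
    rewrite (_ : p *~ _ + _ = (v + p *~ (c * m)) *+ n); first by ring.
    by rewrite mulrnDl addrC !pmulrn -mulrzA; congr (_ + _ *~ _); ring.
  by rewrite [ip _ g]/ip -mulrA -exprSr ler_norml => /andP[? ?]; lra.
(* Some term is at least as large as the average. *)
have [m mms A3] : exists2 m : int, m \in ms & k%:R * (4 * eta) <
    Lam (f * shift ((v + p *~ (c * m)) *+ n) f * g ^+ k).
  apply: contrapT => nom.
  have : (size ms)%:R^-1 * \sum_(b <- ms) Lam (f * shift ((v + p *~ (c * b)) *+ n) f * g ^+ k)
      <= k%:R * (4 * eta).
    have sms : 0 < (size ms)%:R :> R by rewrite ltr0n lt0n size_eq0.
    rewrite mulrC ler_pdivrMr // mulr_natr -sum1_size -sumrMnr.
    rewrite big_seq [leRHS]big_seq; apply: ler_sum => m mms.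
    by rewrite mulr1n leNgt; apply/negP => ?; apply: nom; exists m.
  move: A1 A2; rewrite -natr1; move: XE eta0; lra.
exists m => w u uk; have [lw lwS lwle] := mgood m mms.
have lwn : lists (multiples n) lw.
  apply: lists_sub lwS => _ [b _ <-]; exists (w *~ (b * D)) => //.
  by rewrite pmulrn -mulrzA; congr (_ *~ _); ring.
have F1 x : `|(f * shift (w *+ n) f) x| <= 1 by rewrite bfunM shiftE normrM mulr_ile1.
have H1 y x : `|shift (y *+ n) (avg lw f) x| <= 1 by rewrite shiftE.
have Hg y : nrm (shift (y *+ n) (avg lw f) - g) <= 4 * eta.
  by apply: near_shift => //; exists y.
have := mean_prod_close u eta40 F1 g1 H1 Hg.
rewrite uk ler_norml => /andP[A4 _].
(* At a point where the product is positive every factor is; a positive average of f over multiples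
   of w then has a positive term, which supplies b. *)
have /mean_gt0_ex[x] : 0 < Lam (f * shift (w *+ n) f *
    \prod_(y <- u) shift (y *+ n) (avg lw f)) by move: A3 A4; lra.
have f0 z : 0 <= f z by case/andP: (f01 z).
rewrite bfunM bfunM shiftE => pos.
have prod0 : 0 <= (\prod_(y <- u) shift (y *+ n) (avg lw f)) x.
  by rewrite bfun_prod prodr_ge0 // => y _; case/andP: (avg01 lw (x + y *+ n)).
exists x; split.
- rewrite lt_neqAle f0 eq_sym andbT; apply: contraTneq pos => ->.
  by rewrite !mul0r ltxx.
- rewrite lt_neqAle f0 eq_sym andbT; apply: contraTneq pos => ->.
  by rewrite mulr0 mul0r ltxx.
move=> y yu; have /avg_gt0_ex[h /lwS.2[b _ <-] fh] : 0 < avg lw f (x + y *+ n).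
  rewrite lt_neqAle eq_sym; case/andP: (avg01 lw (x + y *+ n)) => -> _.
  rewrite andbT; apply: contraTneq pos => y0.
  by rewrite bfun_prod (perm_big _ (perm_to_rem yu)) big_cons shiftE y0 /= mul0r mulr0 ltxx.
by exists b.
Qed.
End InvariantMean.

(** * Transvections *)

Section Transvections.

(** Two block-triangular factorizations of one matrix give the two determinants. *)
Lemma det_1D_mulmxC (A : comNzRingType) m n (B : 'M[A]_(m, n)) (C : 'M[A]_(n, m)) :
  \det (1%:M + B *m C) = \det (1%:M + C *m B).
Proof.
transitivity (\det (block_mx 1%:M (- C) B 1%:M)).
  have -> : block_mx 1%:M (- C) B 1%:M =
      block_mx 1%:M 0 B 1%:M *m block_mx 1%:M (- C) 0 (1%:M + B *m C).
    by rewrite mulmx_block ?(mulmx1, mul1mx, mulmx0, mul0mx, addr0) mulmxN addrCA addNr addr0.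
  by rewrite det_mulmx det_lblock det_ublock !det1 !mul1r.
have -> : block_mx 1%:M (- C) B 1%:M =
    block_mx (1%:M + C *m B) (- C) 0 1%:M *m block_mx 1%:M 0 B 1%:M.
  by rewrite mulmx_block ?(mulmx1, mul1mx, mulmx0, mul0mx, add0r) mulNmx addrK.
by rewrite det_mulmx det_lblock det_ublock !det1 !mulr1.
Qed.

Lemma det_transvection (A : comNzRingType) n (p : 'cV[A]_n) (q : 'rV[A]_n) :
  q *m p = 0 -> \det (1%:M + p *m q) = 1.
Proof. by move=> qp; rewrite det_1D_mulmxC qp addr0 det1. Qed.

(** Two coordinates suffice: q = p_1 e_0 - p_0 e_1, or e_0 when p_0 = 0. In dimension one p would
    have to vanish. *)
Lemma ex_orthogonal_row n (p : 'cV[int]_n) : (2 <= n)%N ->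
  exists2 q : 'rV[int]_n, q != 0 & q *m p = 0.
Proof.
move=> n2; pose i0 : 'I_n := Ordinal (ltnW n2); pose i1 : 'I_n := Ordinal n2.
have dp i : (delta_mx 0 i : 'rV_n) *m p = (p i 0)%:M.
  by rewrite -rowE; apply/matrixP => a b; rewrite !ord1 !mxE eqxx mulr1n.
have [p00|p00] := eqVneq (p i0 0) 0.
  exists (delta_mx 0 i0); last by rewrite dp p00; apply/matrixP => a b; rewrite !mxE mul0rn.
  by apply/matrix0Pn; exists 0, i0; rewrite mxE !eqxx oner_neq0.
exists (p i1 0 *: delta_mx 0 i0 - p i0 0 *: delta_mx 0 i1).
  apply/matrix0Pn; exists 0, i1; rewrite !mxE !eqxx /=.
  by rewrite mulr0 mulr1 sub0r oppr_eq0.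
rewrite mulmxBl -!scalemxAl !dp !scale_scalar_mx mulrC subrr //.
Qed.

Definition columns n (v : 'I_n -> 'cV[int]_n) : 'M[int]_n := \matrix_(i, k) v k i 0.

Lemma mulmx_columns n m (A : 'M[int]_(m, n)) (v : 'I_n -> 'cV[int]_n) i k :
  (A *m columns v) i k = (A *m v k) i 0.
Proof. by rewrite !mxE; apply: eq_bigr => j _; rewrite mxE. Qed.

Lemma det_columns_neq0 n (v : 'I_n -> 'cV[int]_n) : lin_indep v -> \det (columns v) != 0.
Proof.
move=> indep; rewrite -det_tr; apply/det0P => -[c c0 cV].
move/negP: c0; apply; apply/eqP/rowP => k; rewrite mxE; apply: (indep (c 0)).
apply/colP => i; move/rowP: cV => /(_ i); rewrite !mxE summxE => cVi.
by rewrite -[RHS]cVi; apply: eq_bigr => j _; rewrite !mxE.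
Qed.

Lemma scalez_mulrz n (x : 'cV[int]_n) (a : int) : a *: x = x *~ a.
Proof. by rewrite -[RHS]scaler_int intz. Qed.

(* The row [S *m \adj U] has product [D * S k] with the k-th column of U. *)
Lemma SL_orbit n (v : 'I_n -> 'cV[int]_n) (p : 'cV[int]_n) : (2 <= n)%N -> lin_indep v ->
  exists j c D, [/\ c != 0, D != 0 & forall m : int,
    exists u : 'I_n -> 'cV[int]_n, forall b : 'I_n -> int, exists2 g, \det g = 1 &
      let w := v j + p *~ (c * m) in
      g *m v j = w /\ forall k, k != j -> g *m v k = u k + w *~ (b k * D)].
Proof.
move=> n2 indep; have [q q0 qp] := ex_orthogonal_row p n2.
set D := \det (columns v); have D0 : D != 0 := det_columns_neq0 indep.
(* As the matrix of the v k is nonsingular, q cannot annihilate all its columns; j is a column with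
   c = q v_j nonzero. *)
have /matrix0Pn[a [j]] : q *m columns v != 0.
  by apply: contraNneq D0 => qv; apply/det0P; exists q.
rewrite ord1 mulmx_columns {a}; set c := (q *m v j) 0 0 => c0.
exists j, c, D; split=> // m.
pose g1 : 'M[int]_n := 1%:M + (m *: p) *m q.
have g1det : \det g1 = 1 by apply: det_transvection; rewrite -scalemxAr qp scaler0.
have g1j : g1 *m v j = v j + p *~ (c * m).
  rewrite mulmxDl mul1mx -mulmxA [q *m v j]mx11_scalar -/c mul_mx_scalar scalerA.
  by rewrite scalez_mulrz.
pose U := g1 *m columns v; have detU : \det U = D by rewrite det_mulmx g1det mul1r.
exists (fun k => g1 *m v k) => b; set w := v j + _.
(* The zero entry at j makes the second row vector annihilate w, so [g2] fixes w and has determinant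
   1. *)
pose S : 'rV[int]_n := \row_k (if k == j then 0 else b k).
pose g2 : 'M[int]_n := 1%:M + w *m (S *m \adj U).
have SU k : S *m \adj U *m (g1 *m v k) = (S 0 k * D)%:M.
  apply/matrixP => x y; rewrite !ord1 mulmxA -mulmx_columns -!mulmxA -/U mul_adj_mx detU.
  by rewrite mul_mx_scalar !mxE eqxx mulr1n mulrC.
have g2g1 k : g2 *m (g1 *m v k) = g1 *m v k + w *~ (S 0 k * D).
  by rewrite mulmxDl mul1mx -[w *m _ *m _]mulmxA SU mul_mx_scalar scalez_mulrz.
exists (g2 *m g1).
  rewrite det_mulmx g1det mulr1; apply: det_transvection.
  by rewrite /w -g1j SU mxE eqxx mul0r; apply/matrixP => x y; rewrite !mxE mul0rn.
split=> [|k kj]; rewrite -mulmxA g2g1 mxE.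
  by rewrite eqxx mul0r mulr0z addr0.
by rewrite (negPf kj).
Qed.
End Transvections.

(** * Construction of the invariant mean *)

Section UltrafilterMean.
Variables (R : realType) (T : zmodType).
Local Notation bfun := (bfun R T).

(** By compactness of the segment the image ultrafilter has a cluster point, and an ultrafilter
    converges to its cluster points. *)
Lemma ultra_cvg_bounded (U : set_system nat) (u : nat -> R) (C : R) :
  UltraFilter U -> (forall i, `|u i| <= C) -> cvg (u @ U).
Proof.
move=> UU uC; have FU : ProperFilter (u @ U) by exact: fmap_proper_filter.
have [|l [_ lcl]] := @segment_compact R (- C) C (u @ U) FU.
  suff : U (u @^-1` `[- C, C]) by [].
  by apply: filterE => i; rewrite /= in_itv/= -ler_norml uC.
apply: (cvgP l) => B Bl.
have [//|UB] := in_ultra_setVsetC (u @^-1` B) UU.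
by have [x [nBx /nBx]] := lcl (~` B) B UB Bl.
Qed.

Variables (U : set_system nat) (UU : UltraFilter U).
Variable a : nat -> {scalar bfun}.
Hypothesis a_ge0 : forall i (F : bfun), (forall x, 0 <= F x) -> 0 <= a i F.
Hypothesis a1 : forall i, a i 1 = 1.

Definition ulim F := lim ((fun i => a i F) @ U).

Lemma ulim_cvg F : (fun i => a i F) @ U --> ulim F.
Proof.
have /bounded_fctP[C FC] := bfun_bounded F.
by apply: (@ultra_cvg_bounded U _ C) => i; exact: (positive_norm_le (@a_ge0 i) (a1 i)).
Qed.

Fact ulim_is_scalar : scalar ulim.
Proof.
move=> c F H; apply: cvg_lim => //.
under eq_fun do rewrite linearP.
by apply: cvgD; [apply: cvgMr|]; exact: ulim_cvg.
Qed.

Lemma ulim_ge F c : (forall i, c <= a i F) -> c <= ulim F.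
Proof.
move=> ca; apply: limr_ge; first exact: ulim_cvg.
by apply: filterE.
Qed.

Lemma ulim1 : ulim 1 = 1.
Proof. by apply: cvg_lim => //; under eq_fun do rewrite a1; exact: cvg_cst. Qed.

(** A difference vanishing along the cofinite filter also vanishes along the finer U. *)
Lemma ulim_shift h : \oo `<=` U ->
  (forall F, (fun i => a i (shift h F) - a i F) @ \oo --> (0 : R)) ->
  forall F, ulim (shift h F) = ulim F.
Proof.
move=> ooU ah F; apply/eqP; rewrite -subr_eq0; apply/eqP.
have d0 : (fun i => a i (shift h F) - a i F) @ U --> (0 : R).
  by apply: cvg_trans (ah F); exact: cvg_app.
have d1 : (fun i => a i (shift h F) - a i F) @ U --> ulim (shift h F) - ulim F.
  by apply: cvgB; exact: ulim_cvg.
by rewrite -(cvg_lim _ d1) // (cvg_lim _ d0).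
Qed.

Lemma ulim_invariant : \oo `<=` U ->
  (forall h F, (fun i => a i (shift h F) - a i F) @ \oo --> (0 : R)) ->
  invariant_mean ulim.
Proof.
move=> ooU ah; split; first exact: ulim1.
  by move=> F F0; apply: ulim_ge => i; exact: a_ge0.
by move=> h; exact: ulim_shift.
Qed.
End UltrafilterMean.

(** * Averages over boxes *)

Section BoxAverages.
Variables (R : realType) (r : nat).
Local Notation bfun := (bfun R 'cV[int]_r).
Implicit Types F : bfun.

(** The side is n.+1, so no box is empty; offsets form a finite type that permutations can
    reindex. *)
Definition box_point n (v : 'cV[int]_r) (w : {ffun 'I_r -> 'I_n.+1}) : 'cV[int]_r :=
  v + \col_j (w j)%:Z.

Definition box_avg n (v : 'cV[int]_r) (F : bfun) : R :=
  (n.+1%:R ^+ r)^-1 * \sum_(w : {ffun 'I_r -> 'I_n.+1}) F (box_point v w).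

Fact box_avg_is_scalar n v : scalar (box_avg n v).
Proof.
move=> c F H; rewrite /box_avg; under eq_bigr do rewrite bfunD bfunZ.
by rewrite big_split -mulr_sumr mulrDr mulrCA.
Qed.
HB.instance Definition _ n v :=
  GRing.isLinear.Build R bfun R _ (box_avg n v) (@box_avg_is_scalar n v).

Lemma card_box n : #|{: {ffun 'I_r -> 'I_n.+1}}|%:R = n.+1%:R ^+ r :> R.
Proof. by rewrite card_ffun !card_ord natrX. Qed.

Lemma box_avg_ge0 n v F : (forall x, 0 <= F x) -> 0 <= box_avg n v F.
Proof. by move=> F0; rewrite mulr_ge0 ?invr_ge0 ?exprn_ge0 ?sumr_ge0. Qed.

Lemma box_avg1 n v : box_avg n v 1 = 1.
Proof.
rewrite /box_avg (eq_bigr (fun=> 1)) // sumr_const card_box.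
by rewrite mulVf // expf_neq0.
Qed.

(** Multiplying by the side avoids the exponent r - 1. The sum factors over the coordinates, and
    coordinate j contributes 1. *)
Lemma card_box_face n j : n.+1%:R * \sum_(w : {ffun 'I_r -> 'I_n.+1}) (w j == ord_max)%:R
  = n.+1%:R ^+ r :> R.
Proof.
pose g i (a : 'I_n.+1) : R := if i == j then (a == ord_max)%:R else 1.
have -> : \sum_(w : {ffun 'I_r -> 'I_n.+1}) (w j == ord_max)%:R =
    \sum_(w : {ffun 'I_r -> 'I_n.+1}) \prod_i g i (w i).
  apply: eq_bigr => w _; rewrite (bigD1 j) //= {1}/g eqxx big1 ?mulr1 //.
  by move=> i /negPf ij; rewrite /g ij.
rewrite -bigA_distr_bigA (bigD1 j) //= (bigD1 ord_max) //= {1}/g !eqxx.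
rewrite big1 ?addr0 ?mul1r => [|a /negPf am]; last by rewrite /g eqxx am.
transitivity (\prod_(i < r) n.+1%:R : R); last by rewrite prodr_const card_ord.
rewrite [RHS](bigD1 j) //=; congr (_ * _); apply: eq_bigr => i /negPf ij.
by rewrite (eq_bigr (fun=> 1)) => [|a _]; rewrite ?sumr_const ?card_ord // /g ij.
Qed.

(* Shifting cyclically along coordinate j permutes the box and differs from the
   translation by the j-th basis vector only on one face. *)
Lemma box_avg_shift n v j F C : (forall x, `|F x| <= C) ->
  `|box_avg n v (shift (delta_mx j 0) F) - box_avg n v F| <= 2 * C / n.+1%:R.
Proof.
move=> FC.
pose t (w : {ffun 'I_r -> 'I_n.+1}) := [ffun i => if i == j then ordS (w i) else w i].
have t_inj : injective t.
  move=> w w' /ffunP tw; apply/ffunP => i; move: (tw i); rewrite !ffunE.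
  by case: eqP => // _ /ordS_inj.
have N0 : n.+1%:R != 0 :> R by [].
rewrite /box_avg -mulrBr [X in _ - X](reindex_inj t_inj) -sumrB normrM.
rewrite (@ger0_norm _ (_ ^-1)) ?invr_ge0 ?exprn_ge0 // mulrC ler_pdivrMr ?exprn_gt0 //.
rewrite (_ : _ / _ * _ = 2 * C * \sum_(w : {ffun 'I_r -> 'I_n.+1}) (w j == ord_max)%:R);
  last by rewrite -(card_box_face n j); field.
apply: le_trans (ler_norm_sum _ _ _) _; rewrite mulr_sumr; apply: ler_sum => w _.
have [wj|wj] := eqVneq (w j) ord_max.
  by rewrite mulr1 mulr_natl mulr2n (le_trans (ler_normB _ _)) // lerD ?shiftE.
suff -> : box_point v (t w) = box_point v w + delta_mx j 0.
  by rewrite shiftE subrr normr0 /= mulr0.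
rewrite /box_point -addrA; congr (v + _); apply/colP => i; rewrite !mxE !ffunE.
case: (eqVneq i j) => [->|ij]; last by rewrite addr0.
rewrite eqxx /= modn_small; first by rewrite -PoszD addn1.
by rewrite ltn_neqAle ltn_ord andbT; apply: contra wj => /eqP[wn]; apply/eqP/val_inj.
Qed.

(** The translations with this property for all F form a subgroup, which contains the basis
    vectors. *)
Lemma box_avg_shift_cvg (n : nat -> nat) (v : nat -> 'cV[int]_r) h F :
  (forall i, (i <= n i)%N) ->
  (fun i => box_avg (n i) (v i) (shift h F) - box_avg (n i) (v i) F) @ \oo --> (0 : R).
Proof.
move=> ni; pose S : set 'cV[int]_r := [set h | forall F,
  (fun i => box_avg (n i) (v i) (shift h F) - box_avg (n i) (v i) F) @ \oo --> (0 : R)].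
have gS : subgroup S.
  split=> [F'|x y Sx Sy F'].
    by under eq_fun do rewrite shift0 subrr; exact: cvg_cst.
  set H := shift (- y) F'.
  have -> : (fun i => box_avg (n i) (v i) (shift (x - y) F') - box_avg (n i) (v i) F') =
     (fun i => (box_avg (n i) (v i) (shift x H) - box_avg (n i) (v i) H)
             - (box_avg (n i) (v i) (shift y H) - box_avg (n i) (v i) H)).
    apply/funext => i; rewrite -!shift_add subrr shift0.
    by rewrite opprB addrA subrK.
  by rewrite -(subr0 0); apply: cvgB; [exact: Sx|exact: Sy].
have Sd j : S (delta_mx j 0).
  move=> F'; have /bounded_fctP[C FC] := bfun_bounded F'.
  have C0 : (fun i => 2 * C / i.+1%:R) @ \oo --> (0 : R).
    by rewrite -(mulr0 (2 * C)); apply: cvgMr; exact: cvg_harmonic.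
  have C0N : (fun i => - (2 * C / i.+1%:R)) @ \oo --> (0 : R).
    by rewrite -oppr0; exact: cvgN.
  apply: (squeeze_cvgr _ C0N C0); apply: nearW => i.
  rewrite -ler_norml; apply: le_trans (box_avg_shift _ _ _ FC) _.
  rewrite ler_wpM2l // ?mulr_ge0 ?(le_trans (normr_ge0 _) (FC 0)) //.
  by rewrite lef_pV2 ?posrE ?ltr0n // ler_nat ltnS.
have -> : h = \sum_(j < r) delta_mx j 0 *~ h j 0.
  rewrite {1}[h]matrix_sum_delta; apply: eq_bigr => j _; rewrite big_ord1.
  by rewrite scalez_mulrz.
move: F; apply: (big_ind S); first by case: gS.
  by move=> x y; exact: subgroupD.
by move=> j _; exact: subgroupMz gS (Sd j).
Qed.

Lemma box_avg_density n v E (D : bfun) : (forall x, D x = (x \in E)%:R) ->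
  (#|` fset_set (E `&` [set v + w | w in cube r n.+1])|)%:R / n.+1%:R ^+ r
    <= box_avg n v D :> R.
Proof.
move=> DE; rewrite mulrC ler_wpM2l ?invr_ge0 ?exprn_ge0 //.
pose s := [seq box_point v w | w <- enum {: {ffun 'I_r -> 'I_n.+1}} & box_point v w \in E].
set X := E `&` _.
have Xs : X `<=` [set` s].
  move=> y [+ [w wn yw]]; rewrite -{}yw => Ey; apply/mapP.
  pose g : {ffun 'I_r -> 'I_n.+1} := [ffun i => inord `|w i 0%R|%N].
  have gw : v + w = box_point v g.
    congr (_ + _); apply/colP => i; rewrite mxE ffunE.
    have /andP[w0 wN] := wn i; rewrite inordK; first by rewrite gez0_abs.
    by lia.
  by exists g => //; rewrite mem_filter mem_enum andbT -gw; exact: mem_set.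
(* Finiteness is what makes [fset_set] have the elements of X rather than its default, the empty
   set. *)
have finX : finite_set X by apply: sub_finite_set Xs _; exact: finite_seq.
have -> : \sum_(w : {ffun 'I_r -> 'I_n.+1}) D (box_point v w) = (size s)%:R.
  rewrite size_map size_filter -sum1_count natr_sum big_enum_cond /=.
  rewrite [RHS]big_mkcond /=; apply: eq_bigr => w _; rewrite DE.
  by case: (box_point v w \in E).
rewrite ler_nat; apply: uniq_leq_size; first exact: fset_uniq.
by move=> x; rewrite in_fset_set // inE => /Xs.
Qed.
End BoxAverages.

(** * From upper Banach density to an invariant mean *)

Lemma upper_density_boxes (R : realType) r (E : set 'cV[int]_r) :
  (0 < upper_banach_density R E)%E -> exists2 d : R, 0 < d &
  forall i, exists n v, (i <= n)%N /\
    d <= (#|` fset_set (E `&` [set v + w | w in cube r n.+1])|)%:R / n.+1%:R ^+ r.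
Proof.
rewrite /upper_banach_density /limn_esup /limf_esup; set L := ereal_inf _ => L0.
(* L may a priori be infinite, hence a real d strictly between 0 and L. *)
have [d d0 dL] : exists2 d : R, 0 < d & (d%:E < L)%E.
  case: L L0 => [l| |] //= l0; last by exists 1; rewrite ?ltry.
  by exists (l / 2); rewrite ?lte_fin in l0 *; rewrite ?divr_gt0 // ltr_pdivrMr // ltr_pMr // ltr1n.
exists d => // i; pose V := [set n | (i < n)%N].
have ooV : \oo V by exists i.+1.
have /(lt_le_trans dL) : (L <= ereal_sup ((fun n : nat =>
    ereal_sup [set ((#|` fset_set (E `&` [set v + w | w in cube r n])|)%:R
                      / n%:R ^+ r)%:E | v in [set: 'cV[int]_r]]) @` V))%E.
  by apply: ereal_inf_lbound; exists V.
move=> /ereal_sup_gt[_ [[|n] // ni <-]] /ereal_sup_gt[_ [v _ <-]].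
by rewrite lte_fin => dn; exists n, v; split => //; exact: ltW.
Qed.

Lemma ex_indicator (R : realType) T (E : set T) :
  exists D : bfun R T, forall x, D x = (x \in E)%:R.
Proof.
have b : (fun x => (x \in E)%:R : R) \in bounded_fct.
  by apply/bounded_fctP; exists 1 => x; rewrite normr_nat lern1; case: (x \in E).
by exists (BFun b).
Qed.

Lemma ex_invariant_mean (R : realType) r (E : set 'cV[int]_r) (D : bfun R 'cV[int]_r) :
  (forall x, D x = (x \in E)%:R) -> (0 < upper_banach_density R E)%E ->
  exists2 Lam : {scalar bfun R 'cV[int]_r}, invariant_mean Lam & 0 < Lam D.
Proof.
move=> DE /upper_density_boxes[d d0] /choice[n] /choice[v nv].
(* An ultrafilter finer than the cofinite filter; the boxes grow along it. *)
have [U [UU ooU]] := ultraFilterLemma (@eventually_filter).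
pose a i : {scalar bfun R 'cV[int]_r} := box_avg (n i) (v i).
have a0 i (F : bfun R 'cV[int]_r) : (forall x, 0 <= F x) -> 0 <= a i F by exact: box_avg_ge0.
have a1 i : a i 1 = 1 by exact: box_avg1.
pose Lam : {scalar bfun R 'cV[int]_r} := HB.pack (ulim U a)
  (GRing.isLinear.Build R _ R _ (ulim U a) (ulim_is_scalar UU a0 a1)).
exists Lam.
  apply: ulim_invariant => // h F; apply: box_avg_shift_cvg => i.
  by case: (nv i).
apply: lt_le_trans d0 _; apply: ulim_ge => // i.
by have [_ /le_trans] := nv i; apply; exact: box_avg_density.
Qed.

(** * Generators of Z^r and the conclusion *)

Lemma span_delta r (e : seq 'I_r) (c : 'I_r -> int) :
  span [seq delta_mx i 0 | i <- e] (\sum_(i <- e) delta_mx i 0 *~ c i : 'cV[int]_r).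
Proof.
elim: e => [|i e IH]; first by rewrite big_nil.
by exists (c i); rewrite big_cons addrC addKr.
Qed.

Lemma ex_generators r : (0 < r)%N ->
  exists (a : 'cV[int]_r) s, span (a :: s) = setT.
Proof.
move=> r0; have : size (enum 'I_r) = r by rewrite size_enum_ord.
case eE : (enum 'I_r) => [|i e] er; first by rewrite -er in r0.
exists (delta_mx i 0), [seq delta_mx k 0 | k <- e].
rewrite -subTset => x _; have := span_delta (i :: e) (fun k => x k 0).
congr (span _ _); rewrite -eE big_enum /= [RHS]matrix_sum_delta.
by apply: eq_bigr => k _; rewrite big_ord1 scalez_mulrz.
Qed.

Theorem theorem1p4 (R : realType) (r : nat) (r_ge2 : (2 <= r)%N)
    (E : set 'cV[int]_r) (dE : (0 < upper_banach_density R E)%E) :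
  exists n : nat, (0 < n)%N /\
    forall v : 'I_r -> 'cV[int]_r, lin_indep v ->
      exists v0 : 'cV[int]_r, exists g : 'M[int]_r,
        [/\ E v0, SLZ r g & forall k : 'I_r, E (v0 + (g *m v k) *+ n)].
Proof.
have [f fE] := ex_indicator R E.
have [Lam mean_Lam Lf] := ex_invariant_mean fE dE.
have f01 x : 0 <= f x <= 1 by rewrite fE ler0n lern1; case: (x \in E).
have fpos x : 0 < f x -> E x.
  by rewrite fE; case: (boolP (x \in E)) => [/set_mem//|]; rewrite ltxx.
have [a [s spanT]] := ex_generators (ltnW r_ge2).
have [n n0 [p rec]] := recurrence mean_Lam f01 r spanT Lf.
exists n; split=> // v indep.
(* The two results alternate: the orbit gives j, c, D, recurrence gives m, the orbit gives u,
   recurrence gives x and b, and the orbit gives g. *)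
have [j [c [D [c0 D0 orb]]]] := SL_orbit p r_ge2 indep.
have [m mP] := rec (v j) c D c0 D0; have [u uP] := orb m.
have [|x [/fpos Ex /fpos Exw xu]] := mP [seq u k | k <- enum 'I_r].
  by rewrite size_map size_enum_ord.
have /choice[b bP] k : exists b : int,
    0 < f (x + u k *+ n + (v j + p *~ (c * m)) *~ (b * (n%:Z * D))).
  by apply: xu; apply: map_f; rewrite mem_enum.
have [g g1 [gj gk]] := uP b; exists x, g; split=> // k.
have [->|kj] := eqVneq k j; first by rewrite gj.
(* The translation n u_k + b n D w is n times g v_k. *)
rewrite gk // mulrnDl addrA; apply: fpos; move: (bP k).
by congr (0 < f (_ + _)); rewrite [RHS]pmulrn -mulrzA; congr (_ *~ _); ring.
Qed.
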